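(* Let $n\geq2$. The complement in $\mathbb{R}^n$ of a closed (Euclidean) ball $\overline{B}$ of $\mathbb{R}^n$ is a polynomial image of $\mathbb{R}^{n+1}$.
   Context: A set $S\subset\mathbb{R}^n$ is a polynomial image of $\mathbb{R}^{m}$ if $S=f(\mathbb{R}^{m})$ for some map $f:\mathbb{R}^{m}\to\mathbb{R}^n$ with polynomial components. Balls have positive finite radius. *)

(* Defs.v *)
From mathcomp Require Import all_boot all_order all_algebra.
From mathcomp Require Import classical_sets reals.
From mathcomp Require Import mpoly.

Set Implicit Arguments.
Unset Strict Implicit.
Unset Printing Implicit Defensive.

Import Order.TTheory GRing.Theory Num.Theory.

Local Open Scope ring_scope.
Local Open Scope classical_set_scope.

Section PolynomialImages.
Variable R : realType.

Definition polynomial_map (m n : nat) (f : 'rV[R]_m -> 'rV[R]_n) : Prop :=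
  exists p : 'I_n -> {mpoly R[m]},
    forall (x : 'rV[R]_m) (i : 'I_n), f x 0 i = (p i).@[x 0].

Definition polynomial_image (m n : nat) (S : set 'rV[R]_n) : Prop :=
  exists2 f : 'rV[R]_m -> 'rV[R]_n, polynomial_map f & S = range f.

(* The norm that the library puts on row vectors is the sup norm, hence an
   explicit definition of the Euclidean one. *)
Definition euclidean_norm (n : nat) (x : 'rV[R]_n) : R :=
  Num.sqrt (\sum_(i < n) x 0 i ^+ 2).

Definition closed_euclidean_ball (n : nat) (c : 'rV[R]_n) (r : R) :
    set 'rV[R]_n :=
  [set x | euclidean_norm (x - c) <= r].

End PolynomialImages.

(* Main.v *)
(** Let [s = |X|^2], [w = 1 - s] and [q = s + w^2] for [X] in R^(n-1). The vector
    [(s - w^2, 2 w X)] has norm exactly [q], and its direction runs through the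
    whole sphere: it is the inverse stereographic image of the point [(w : X)]
    of projective space. Multiplying it by [(1 + N) / q] gives a vector of norm
    [1 + N], so it suffices to find [N (s, y, t)] with range (0, +oo) for each
    [s >= 0] and such that [q] divides [1 + N]. As [q] divides [1 + s^3], one may
    take [N = s A^2 + q ((A t - 1)^2 + A^2)] with [A = q y - s]. *)

Require Import Defs.
From mathcomp Require Import all_boot all_order all_algebra.
From mathcomp Require Import classical_sets reals mpoly ring lra.

Set Implicit Arguments.
Unset Strict Implicit.
Unset Printing Implicit Defensive.

Import Order.TTheory GRing.Theory Num.Theory.

Local Open Scope ring_scope.
Local Open Scope classical_set_scope.

Section Dilation.
Variable K : comNzRingType.
Implicit Types s y t : K.

Definition dir_norm s : K := 1 - s + s ^+ 2.

Definition excess s y t : K :=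
  let A := dir_norm s * y - s in
  s * A ^+ 2 + dir_norm s * ((A * t - 1) ^+ 2 + A ^+ 2).

(** The quotient of [1 + excess s y t] by q = [dir_norm s], written without division: s A^2 expands
    to s^3 - 2 q s^2 y + s q^2 y^2, and 1 + s^3 = (1 + s) q. *)
Definition dilation s y t : K :=
  let A := dir_norm s * y - s in
  1 + s - (s ^+ 2 * y) *+ 2 + s * dir_norm s * y ^+ 2
  + (A * t - 1) ^+ 2 + A ^+ 2.

Lemma dilationE s y t : dilation s y t * dir_norm s = 1 + excess s y t.
Proof. by rewrite /dilation /excess /dir_norm /=; ring. Qed.

End Dilation.

Lemma rmorph_dir_norm (K L : comNzRingType) (h : {rmorphism K -> L}) (s : K) :
  h (dir_norm s) = dir_norm (h s).
Proof. by rewrite /dir_norm rmorphD rmorphB rmorph1 rmorphXn. Qed.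

Lemma rmorph_dilation (K L : comNzRingType) (h : {rmorphism K -> L})
    (s y t : K) :
  h (dilation s y t) = dilation (h s) (h y) (h t).
Proof.
by rewrite /dilation /= !(rmorphD, rmorphN, rmorph1, rmorphXn, rmorphMn,
  rmorphM, rmorph_dir_norm).
Qed.

Section RealClosed.
Variable R : rcfType.
Implicit Types s y t u v : R.

Lemma dir_norm_gt0 s : 0 < dir_norm s.
Proof. by rewrite /dir_norm; nra. Qed.

(** A t - 1 and A have no common zero, although the sum of their squares comes arbitrarily close to
    0. *)
Lemma excess_gt0 s y t : 0 <= s -> 0 < excess s y t.
Proof.
move=> s0; rewrite /excess; set A := _ * y - s.
have q0 := dir_norm_gt0 s.
apply: ltr_wpDl; first by rewrite mulr_ge0 ?sqr_ge0.
rewrite mulr_gt0 //.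
have [->|A0] := eqVneq A 0; first by lra.
by rewrite ltr_wpDl ?sqr_ge0 // exprn_even_gt0.
Qed.

Lemma excess_surj s u : 0 <= s -> 0 < u -> exists y t, excess s y t = u.
Proof.
move=> s0 u0; have q0 := dir_norm_gt0 s.
have sq0 : 0 < s + dir_norm s by rewrite ltr_wpDl.
(* Choosing t = 1 / A kills (A t - 1)^2 and leaves (s + q) A^2 as the excess, which dictates A; then
   y solves q y - s = A. *)
pose A := Num.sqrt (u / (s + dir_norm s)).
have A0 : A != 0 by rewrite gt_eqF // sqrtr_gt0 divr_gt0.
exists ((A + s) / dir_norm s), A^-1; rewrite /excess.
have -> : dir_norm s * ((A + s) / dir_norm s) - s = A.
  by field; rewrite gt_eqF.
rewrite mulfV // subrr expr0n add0r -mulrDl sqr_sqrtr; last first.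
  by rewrite divr_ge0 ?ltW.
by field; rewrite gt_eqF.
Qed.

(** Intermediate values on [0, 1]: [dir_norm] is 1 at both ends, where s - (1 - s)^2 equals -1 and
    1. *)
Lemma dir_height_surj v : -1 <= v <= 1 ->
  exists2 s, 0 <= s & s - (1 - s) ^+ 2 = dir_norm s * v.
Proof.
move=> /andP[v1 v2].
pose p : {poly R} := 'X - (1 - 'X) ^+ 2 - (1 - 'X + 'X ^+ 2) * v%:P.
have pE x : p.[x] = x - (1 - x) ^+ 2 - (1 - x + x ^+ 2) * v.
  by rewrite /p !hornerE.
have [|s /andP[s0 _] /rootP] := @poly_ivt R p 0 1 ler01.
  by rewrite !pE; lra.
by rewrite pE => ps; exists s => //; rewrite /dir_norm; lra.
Qed.

Lemma direction_surj m (V : 'I_m.+1 -> R) v :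
  \sum_j V j ^+ 2 + v ^+ 2 = 1 ->
  exists2 X : 'I_m.+1 -> R,
    let s := \sum_j X j ^+ 2 in s - (1 - s) ^+ 2 = dir_norm s * v &
    let s := \sum_j X j ^+ 2 in
    forall j, (1 - s) * X j *+ 2 = dir_norm s * V j.
Proof.
move=> Vv.
have V0 : 0 <= \sum_j V j ^+ 2 by rewrite sumr_ge0 // => j _; rewrite sqr_ge0.
have [|s s0 sv] := @dir_height_surj v; first by apply/andP; split; nra.
have q0 := dir_norm_gt0 s.
(* For s = 1 the direction is the pole v = 1, V = 0, and any unit vector X is sent there. One exists
   because the index type ['I_m.+1] is inhabited, which is where n >= 2 matters. *)
have [s1|s1] := eqVneq s 1.
  have v1 : v = 1 by move: sv; rewrite s1 /dir_norm; lra.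
  have Xs : \sum_(j < m.+1) (j == ord0)%:R ^+ 2 = 1 :> R.
    rewrite (bigD1 ord0) //= big1 ?expr1n ?addr0 // => j /negbTE ->.
    by rewrite expr0n.
  exists (fun j => (j == ord0)%:R); rewrite /= Xs.
    by rewrite v1 /dir_norm; ring.
  move=> j; rewrite subrr mul0r mul0rn.
  have /psumr_eq0P VE : \sum_j V j ^+ 2 = 0 by move: Vv; rewrite v1; lra.
  have /eqP := VE (fun j _ => sqr_ge0 (V j)) j isT.
  by rewrite sqrf_eq0 => /eqP ->; rewrite mulr0.
have w0 : 1 - s != 0 by rewrite subr_eq0 eq_sym.
(* The second equation forces this X. Its squared norm is s since |V|^2 = (1 - v)(1 + v), while q (1
   - v) = 2 (1 - s)^2 and q (1 + v) = 2 s. *)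
pose X j := dir_norm s * V j / ((1 - s) *+ 2).
have sE : \sum_j X j ^+ 2 = s.
  under eq_bigr do rewrite /X mulrAC exprMn.
  rewrite -mulr_sumr.
  have -> : \sum_j V j ^+ 2 = (1 - v) * (1 + v) by lra.
  have q1 : dir_norm s * (1 - v) = (1 - s) ^+ 2 *+ 2.
    by rewrite mulrBr -sv /dir_norm; ring.
  have q2 : dir_norm s * (1 + v) = s *+ 2.
    by rewrite mulrDr -sv /dir_norm; ring.
  rewrite expr_div_n mulrAC expr2 mulrACA q1 q2.
  by field.
exists X; rewrite /= sE // => j.
by rewrite /X; field.
Qed.

End RealClosed.

Lemma euclidean_norm_ge0 (R : realType) n (x : 'rV[R]_n) :
  0 <= euclidean_norm x.
Proof. exact: sqrtr_ge0. Qed.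

Lemma sqr_euclidean_norm (R : realType) n (x : 'rV[R]_n) :
  euclidean_norm x ^+ 2 = \sum_i x 0 i ^+ 2.
Proof. by rewrite sqr_sqrtr // sumr_ge0 // => i _; rewrite sqr_ge0. Qed.

Section ExteriorMap.
Variables (K : comNzRingType) (m : nat).
Implicit Types z : 'I_m.+2 -> K.

(** The variables are [z 0 = y], [z 1 = t] and [z (j + 2) = X j]. *)
Definition tail z (j : 'I_m) : K := z (lift ord0 (lift ord0 j)).

Definition sqr_tail z : K := \sum_j tail z j ^+ 2.

Definition direction z (i : 'I_m.+1) : K :=
  let s := sqr_tail z in
  if unlift ord0 i is Some j then (1 - s) * tail z j *+ 2
  else s - (1 - s) ^+ 2.

Definition exterior z (i : 'I_m.+1) : K :=
  dilation (sqr_tail z) (z ord0) (z (lift ord0 ord0)) * direction z i.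

Lemma sqr_direction z : \sum_i direction z i ^+ 2 = dir_norm (sqr_tail z) ^+ 2.
Proof.
rewrite big_ord_recl /direction unlift_none.
under eq_bigr do rewrite liftK -mulr_natr mulrAC exprMn.
by rewrite -mulr_sumr -/(sqr_tail z) /dir_norm; ring.
Qed.

Lemma sqr_exterior z : \sum_i exterior z i ^+ 2 =
  (1 + excess (sqr_tail z) (z ord0) (z (lift ord0 ord0))) ^+ 2.
Proof.
under eq_bigr do rewrite exprMn.
by rewrite -mulr_sumr sqr_direction -exprMn dilationE.
Qed.

End ExteriorMap.

(** Used with evaluation as the morphism: [exterior] applied to the indeterminates gives the
    polynomials that represent the map. Hence the definitions over an arbitrary commutative ring. *)
Lemma rmorph_exterior (K L : comNzRingType) (h : {rmorphism K -> L}) m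
    (z : 'I_m.+2 -> K) i :
  h (exterior z i) = exterior (h \o z) i.
Proof.
have sE : h (sqr_tail z) = sqr_tail (h \o z).
  by rewrite rmorph_sum; apply: eq_bigr => j _; rewrite rmorphXn.
rewrite rmorphM rmorph_dilation sE /exterior /direction.
case: unliftP => [j|] _; congr (_ * _).
  by rewrite rmorphMn rmorphM rmorphB rmorph1 sE.
by rewrite rmorphB rmorphXn rmorphB rmorph1 sE.
Qed.

(** The direction u fixes X and thereby s; y and t are still free to make the excess d - 1. *)
Lemma exterior_surj (R : rcfType) m (u : 'I_m.+2 -> R) (d : R) :
  1 < d -> \sum_i u i ^+ 2 = 1 ->
  exists z, forall i, exterior z i = d * u i.
Proof.
move=> d1; rewrite big_ord_recl addrC => /direction_surj[X].
set s := \sum_j X j ^+ 2 => /= Xv XV.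
have s0 : 0 <= s by rewrite sumr_ge0 // => j _; rewrite sqr_ge0.
have [|y [t yt]] := @excess_surj _ s (d - 1) s0; first by rewrite subr_gt0.
pose z (k : 'I_m.+3) := if unlift ord0 k is Some k' then
  if unlift ord0 k' is Some j then X j else t else y.
have tailE : tail z =1 X by move=> j; rewrite /tail /z !liftK.
have sE : sqr_tail z = s by apply: eq_bigr => j _; rewrite tailE.
exists z => i; rewrite /exterior sE {1 2}/z unlift_none liftK unlift_none.
have -> : direction z i = dir_norm s * u i.
  rewrite /direction sE; case: unliftP => [j ->|->]; last exact: Xv.
  by rewrite tailE XV.
by rewrite mulrA dilationE yt addrC subrK.
Qed.

Theorem corollary7p2 (R : realType) (n : nat) (hn : (2 <= n)%N)
    (c : 'rV[R]_n) (r : R) (hr : 0 < r) :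
  polynomial_image n.+1 (~` closed_euclidean_ball c r).
Proof.
case: n hn c => [|[|m]] // _ c.
exists (fun x : 'rV[R]_m.+3 => \row_i (c 0 i + r * exterior (x 0) i)).
  exists (fun i => (c 0 i)%:MP + r%:MP * exterior (fun k => 'X_k) i) => x i.
  rewrite mxE mevalD mevalM !mevalC rmorph_exterior.
  congr (_ + _ * exterior _ _); apply/boolp.funext => k /=.
  by rewrite mevalXU.
have r0 : r != 0 by rewrite gt_eqF.
apply/seteqP; split=> [x|_ [z _ <-]] /=; rewrite /closed_euclidean_ball /=.
  move=> /negP; rewrite -ltNge; set d := euclidean_norm _ => rd.
  have d0 : d != 0 by rewrite gt_eqF // (lt_trans hr).
  (* Polar form: x - c is r times d / r > 1 times a unit vector. *)
  have [||z zE] := @exterior_surj R m (fun i => (x - c) 0 i / d) (d / r).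
  - by rewrite ltr_pdivlMr // mul1r.
  - under eq_bigr do rewrite exprMn.
    by rewrite -mulr_suml -sqr_euclidean_norm -exprMn mulfV // expr1n.
  exists (\row_k z k) => //; apply/rowP => i; rewrite mxE.
  have -> : (\row_k z k) 0 = z by apply/boolp.funext => k; rewrite mxE.
  by rewrite zE !mxE; field; rewrite d0.
apply/negP; rewrite -ltNge.
(* After squaring, the claim is r^2 < r^2 (1 + N)^2 with N > 0 the excess. *)
rewrite -(ltr_pXn2r (n := 2)) ?nnegrE ?euclidean_norm_ge0 ?(ltW hr) //.
rewrite sqr_euclidean_norm.
under eq_bigr do rewrite !mxE [c 0 _ + _]addrC addrK exprMn.
rewrite -mulr_sumr sqr_exterior ltr_pMr ?exprn_gt0 // exprn_egt1 // ltrDl.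
by apply: excess_gt0; rewrite sumr_ge0 // => j _; rewrite sqr_ge0.
Qed.
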